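(* Suppose $r_n=o\big((n\log n)^{-1/3}\big)$. Then for every $\varepsilon>0$, $$\mathbb{P}\big(\mathscr C_1(\Gamma_n(r_n,1))\ge \varepsilon n\big)\longrightarrow 0\quad (n\to\infty).$$
   Context: The unit square $[0,1]^2$ is viewed as a torus with distance $d(x,y)=\big(\sum_{i=1}^2\min(|x_i-y_i|,1-|x_i-y_i|)^2\big)^{1/2}$, and $B(x,r)=\{y: d(x,y)<r\}$. Let $\mathbf X=\{X_1,\dots,X_n\}$ be independent uniform points in $[0,1]^2$, and $r_n>0$. $\Gamma_n(r_n,1)$ is the following random graph on $[n]=\{1,\dots,n\}$: independently for each $u$ (and independently of everything else given $\mathbf X$), a point $Y(X_u)$ is chosen uniformly at random from $\mathbf X\cap B(X_u,r_n)$; the digraph $\Gamma_n^+$ has an oriented edge $(u,v)$, $u\ne v$, iff $X_v=Y(X_u)$ (self-selection creates no edge), and $\Gamma_n(r_n,1)$ is the undirected graph with edge $\{u,v\}$ iff $(u,v)$ or $(v,u)$ is in $\Gamma_n^+$. $\mathscr C_1(G)$ denotes the number of vertices of the largest connected component of a graph $G$. *)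

(* Defs.v *)
From HB Require Import structures.
From mathcomp Require Import all_boot all_order all_algebra.
From mathcomp Require Import all_classical all_reals all_analysis.
Set Implicit Arguments. Unset Strict Implicit. Unset Printing Implicit Defensive.
Import Order.TTheory GRing.Theory Num.Theory.
Local Open Scope ring_scope.

Section Defs.
Variable R : realType.

(* torus distance on [0,1]^2 *)
Definition tcoord (a b : R) : R := Num.min `|a - b| (1 - `|a - b|).
Definition tdist (x y : R * R) : R :=
  Num.sqrt (tcoord x.1 y.1 ^+ 2 + tcoord x.2 y.2 ^+ 2).

(* a configuration of n points, encoded by a list s of 2n coordinates *)
Definition pt (s : seq R) (u : nat) : R * R := (nth 0 s (2 * u), nth 0 s (2 * u).+1).

(* index set of X ∩ B(X_u, r) (X_u itself always belongs to it) *)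
Definition nbhd (n : nat) (s : seq R) (r : R) (u : 'I_n) : {set 'I_n} :=
  [set v : 'I_n | tdist (pt s u) (pt s v) < r].

(* the undirected graph generated by a selection function c : u |-> index of Y(X_u) *)
Definition gamma_adj (n : nat) (c : {ffun 'I_n -> 'I_n}) : rel 'I_n :=
  fun u v => (u != v) && ((c u == v) || (c v == u)).

Definition largest_comp (n : nat) (e : rel 'I_n) : nat :=
  \max_(u : 'I_n) #|[set v | connect e u v]|.

Definition sel_prob (n : nat) (s : seq R) (r : R) (c : {ffun 'I_n -> 'I_n}) : R :=
  \prod_(u : 'I_n) (if c u \in nbhd s r u then (#|nbhd s r u|%:R)^-1 else 0).

Definition cond_prob (n : nat) (r eps : R) (s : seq R) : R :=
  \sum_(c : {ffun 'I_n -> 'I_n} | eps * n%:R <= (largest_comp (gamma_adj c))%:R)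
     sel_prob s r c.

Fixpoint iint_unit (k : nat) (F : seq R -> \bar R) : \bar R :=
  match k with
  | 0 => F [::]
  | k.+1 => (\int[lebesgue_measure]_(t in `[0%R, 1%R]%classic)
               iint_unit k (fun s => F (t :: s)))%E
  end.

(* P(C_1(Gamma_n(r,1)) >= eps n) with X_1..X_n iid uniform on [0,1]^2 *)
Definition prob_large_comp (n : nat) (r eps : R) : \bar R :=
  iint_unit (2 * n) (fun s => (cond_prob n r eps s)%:E).

End Defs.

(* Main.v *)
Require Import Defs.
From HB Require Import structures.
From mathcomp Require Import all_boot all_order all_algebra.
From mathcomp Require Import all_classical all_reals all_analysis.
From mathcomp Require Import measurable_realfun ring lra zify.
Import Order.TTheory GRing.Theory Num.Theory numFieldNormedType.Exports.

(** Let [l = ln n], [a = (n l)^(1/3)] and cut the torus into cells of side [1/m]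
with [m] the integer part of [a]; eventually [r <= 1/m]. An exponential moment bound
shows that with high probability no cell has more than [K], of order [n / a^2],
points, so that all degrees are [O(n / a^2)]. At each step a walk
[u, c u, c (c u), ...] stays in place with probability at least [1 / (49 K)], so
no walk makes more than [L], of order [K l = O(a)], steps before repeating
itself. All the walks of one component end in the same cycle; a fixed point of
that cycle is therefore within distance [L r = O(a r) = o(1)] of the whole
component, which then lies in a strip of width [o(1)] and has [o(n)] points. *)

Local Open Scope ring_scope.

(** * Random self-maps with independent values *)


Section ProductWeight.
Variables (R : realFieldType) (T : finType) (w : T -> T -> R).
Hypothesis w_ge0 : forall u v, 0 <= w u v.
Hypothesis w_sum1 : forall u, \sum_v w u v = 1.

Let weight (c : {ffun T -> T}) : R := \prod_u w u (c u).

Lemma weight_ge0 c : 0 <= weight c.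
Proof. by apply: prodr_ge0. Qed.

Lemma weight_sum1 : \sum_c weight c = 1.
Proof.
rewrite /weight -(bigA_distr_bigA w).
by rewrite (eq_bigr (fun=> 1)) ?big1_eq // => u _; rewrite w_sum1.
Qed.

(** Overwriting the value at [u] is a bijection between the maps of [P] with [c u = x] and those
    with [c u = v]; it preserves the product of all other factors. *)
Lemma weight_indep (u v : T) (P : pred {ffun T -> T}) :
  (forall c c' : {ffun T -> T}, (forall x, x != u -> c x = c' x) -> P c = P c') ->
  \sum_(c | P c && (c u == v)) weight c = w u v * \sum_(c | P c) weight c.
Proof.
move=> Pu.
pose upd (c : {ffun T -> T}) x := [ffun y => if y == u then x else c y].
pose rest (c : {ffun T -> T}) := \prod_(y | y != u) w y (c y).
pose N x := \sum_(c | P c && (c u == x)) rest c.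
have NE x : \sum_(c | P c && (c u == x)) weight c = w u x * N x.
  rewrite mulr_sumr; apply: eq_bigr => c /andP[_ /eqP <-].
  by rewrite /weight (bigD1 u).
have Nv x : N x = N v.
  rewrite /N (reindex_onto (upd^~ x) (upd^~ v)) => [|c /andP[_ /eqP cu]]; last first.
    by apply/ffunP => y; rewrite !ffunE; case: eqP => // ->.
  apply: eq_big => [c|c _]; last first.
    by apply: eq_bigr => y /negbTE yu; rewrite ffunE yu.
  rewrite ffunE !eqxx andbT (Pu _ c) => [|y /negbTE yu]; last by rewrite ffunE yu.
  congr (_ && _); apply/eqP/eqP => [<-|cu]; first by rewrite ffunE eqxx.
  by apply/ffunP => y; rewrite !ffunE; case: eqP => // ->.
rewrite [in RHS](partition_big (fun c : {ffun T -> T} => c u) xpredT) //=.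
rewrite [in RHS](eq_bigr (fun x => w u x * N v)) => [|x _]; last by rewrite NE Nv.
by rewrite -mulr_suml w_sum1 mul1r NE.
Qed.

(** A walk that avoids [u] never evaluates the map at [u]. Events about such walks therefore satisfy
    the hypothesis of [weight_indep]. *)
Lemma traject_eq_off (u v : T) (c c' : T -> T) k :
  (forall x, x != u -> c x = c' x) -> u \notin traject c v k ->
  traject c v k = traject c' v k.
Proof.
move=> cc'; elim: k v => //= k IH v; rewrite inE negb_or eq_sym => /andP[vu Hk].
by rewrite cc' // IH // -cc'.
Qed.

(* The visited set [S] is there for the induction: after the first step, the rest
   of the walk avoids [u], hence is independent of [c u]. *)
Lemma weight_uniq_traject (p : R) (S : {set T}) (u : T) (L : nat) :
  p <= 1 -> (forall u, p <= w u u) ->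
  \sum_(c : {ffun T -> T} | uniq (traject c u L.+1) &&
     all (fun x => x \notin S) (traject c u L.+1)) weight c <= (1 - p) ^+ L.
Proof.
move=> p_le1 wp; elim: L S u => [|L IH] S u.
  rewrite expr0 -weight_sum1 big_mkcond /=; apply: ler_sum => c _.
  by case: ifP => // _; exact: weight_ge0.
rewrite (partition_big (fun c : {ffun T -> T} => c u) xpredT) //=.
(* The first step leads to [v]; [u] joins the forbidden set, since uniqueness excludes a return to
   it. *)
pose E v (c : {ffun T -> T}) := uniq (traject c v L.+1) &&
     all (fun x => x \notin u |: S) (traject c v L.+1).
have Eu v c : E v c -> u \notin traject c v L.+1.
  case/andP => _ /allP H; apply/negP => /H.
  by rewrite setU11.
have step v : \sum_(c : {ffun T -> T} | uniq (traject c u L.+2) &&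
     all (fun x => x \notin S) (traject c u L.+2) && (c u == v)) weight c <=
     (v != u)%:R * w u v * (1 - p) ^+ L.
  case: (eqVneq v u) => [->|vu]; rewrite ?mul0r ?mul1r.
    rewrite big1 // => c /andP[/andP[/= /andP[+ _] _] /eqP cu].
    by rewrite cu mem_head.
  rewrite (@le_trans _ _ (\sum_(c | E v c && (c u == v)) weight c)) //.
    rewrite [leLHS]big_mkcond [leRHS]big_mkcond; apply: ler_sum => c _.
    case: ifP => [/andP[/andP[+ +] /eqP cu]|_]; last first.
      by case: ifP => // _; exact: weight_ge0.
    rewrite trajectS cu /E; move: (traject c v L.+1) => t /=.
    move=> /andP[ut Ut] /andP[_ /allP At]; rewrite Ut ?eqxx ?andbT ifT //; apply/allP => x xt.
    rewrite !inE negb_or At // andbT.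
    by apply: contraNneq ut => <-.
  rewrite weight_indep.
    by rewrite ler_wpM2l // IH.
  move=> c c' cc'; apply/idP/idP => H; move: (H); rewrite /E.
    by rewrite (traject_eq_off _ _ _ _ _ cc' (Eu _ _ H)).
  rewrite (@traject_eq_off u v c' c) ?Eu // => x xu.
  by rewrite cc'.
apply: (le_trans (ler_sum _ (fun v _ => step v))).
rewrite -mulr_suml exprS ler_wpM2r ?exprn_ge0 ?subr_ge0 //.
(* The steps that leave [u] have total weight [1 - w u u], at most [1 - p]. *)
have := w_sum1 u; rewrite (bigD1 u) //= [X in _ -> X <= _](bigD1 u) //= eqxx mul0r add0r.
under [X in _ -> X <= _]eq_bigr => v vu do rewrite vu mul1r.
by have := wp u; lra.
Qed.

End ProductWeight.

(** * Components of the graph of a self-map *)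

(** Along a path, an edge [c u = x] lengthens the first walk by one step, and an edge [c x = u]
    lengthens the second one. *)
Lemma connect_gamma_iter {n : nat} (c : {ffun 'I_n -> 'I_n}) u v :
  connect (gamma_adj c) u v -> exists i j, iter i c u = iter j c v.
Proof.
case/connectP => p; elim: p u => [|x p IH] u /=; first by move=> _ ->; exists 0, 0.
case/andP => /andP[_ ux] /IH{}IH /IH{IH} [i [j xv]].
case/orP: ux => /eqP ux.
  by exists i.+1, j; rewrite iterSr ux.
exists i, j.+1; rewrite iterS -xv -iterS iterSr ux //.
Qed.

(** [z] is a point where the walk from [u] closes up. Walks in one component merge, so each of them
    enters this cycle and meets [z]; by [looping] it does so in fewer than [L] steps. *)
Lemma component_attractor {n : nat} (c : {ffun 'I_n -> 'I_n}) L u :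
  (forall v, looping c v L) ->
  exists z, forall v, connect (gamma_adj c) u v -> z \in traject c v L.
Proof.
move=> loopL.
have [i [d cyc]] : exists i d, iter (i + d.+1) c u = iter i c u.
  have /trajectP[i ltiL Ei] := loopL u.
  exists i, (L - i.+1)%N; rewrite -Ei; congr (iter _ _ _).
  lia.
have cyck k : iter (i + k * d.+1) c u = iter i c u.
  elim: k => [|k IH]; first by rewrite addn0.
  by rewrite mulSn addnCA iterD IH -iterD addnC cyc.
exists (iter i c u) => v /connect_gamma_iter [b [a uv]].
(* Going round the cycle [b] times makes the exponent at least [b], so that [b] steps from [u] can
   be exchanged for [a] steps from [v]. *)
have -> : iter i c u = iter (i + b * d.+1 - b + a) c v.
  rewrite iterD -uv -iterD subnK ?cyck //.
  nia.
by have /loopingP := loopL v.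
Qed.

(** * Counting points in cells of the torus *)

Lemma card_mem_seq_le (T : finType) (A : eqType) (f : T -> A) (K : nat) (l : seq A) :
  (forall a, #|[set v | f v == a]| <= K)%N ->
  (#|[set v | f v \in l]| <= size l * K)%N.
Proof.
move=> fK; elim: l => [|a l IH] /=.
  by rewrite mul0n leqn0 cards_eq0; apply/eqP/setP => v; rewrite !inE.
rewrite (_ : [set v | _] = [set v | f v == a] :|: [set v | f v \in l]).
  by rewrite (leq_trans (leq_card_setU _ _)) // mulSn leq_add.
by apply/setP => v; rewrite !inE.
Qed.

Section Torus.
Variable R : realType.
Implicit Types (a b x y : R) (s : seq R) (m n : nat).

Lemma tcoord_ge0 a b : 0 <= a <= 1 -> 0 <= b <= 1 -> 0 <= tcoord a b.
Proof.
move=> a01 b01; rewrite /tcoord le_min normr_ge0 subr_ge0 ler_norml.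
by apply/andP; split; lra.
Qed.

Lemma tcoordxx a : tcoord a a = 0.
Proof. by rewrite /tcoord subrr normr0 subr0 minEle ler01. Qed.

Lemma tcoord_triangle a b c : 0 <= a <= 1 -> 0 <= b <= 1 -> 0 <= c <= 1 ->
  tcoord a c <= tcoord a b + tcoord b c.
Proof.
move=> a01 b01 c01; rewrite /tcoord !minEle.
by case: ifP => H1; case: ifP => H2; case: ifP => H3; move: H1 H2 H3;
  case: (ger0P (a - b)); case: (ger0P (b - c)); case: (ger0P (a - c)); lra.
Qed.

Lemma tcoord1_le_tdist (x y : R * R) : 0 <= tcoord x.1 y.1 -> tcoord x.1 y.1 <= tdist x y.
Proof.
move=> H; rewrite /tdist -[leLHS]ger0_norm // -sqrtr_sqr ler_wsqrtr //.
by rewrite lerDl sqr_ge0.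
Qed.

Lemma tcoord2_le_tdist (x y : R * R) : 0 <= tcoord x.2 y.2 -> tcoord x.2 y.2 <= tdist x y.
Proof.
move=> H; rewrite /tdist -[leLHS]ger0_norm // -sqrtr_sqr ler_wsqrtr //.
by rewrite lerDr sqr_ge0.
Qed.

(** Closed at both ends, so a point may lie in two adjacent cells; only upper bounds on the counts
    matter. *)
Definition cell m (i : nat) : interval R := `[i%:R / m%:R, i.+1%:R / m%:R].

Definition cell_index m x : nat := Num.truncn (m%:R * x).

Lemma mem_cell_index m x : (0 < m)%N -> 0 <= x -> x \in cell m (cell_index m x).
Proof.
move=> m0 x0; have m0R : 0 < m%:R :> R by rewrite ltr0n.
have /truncn_itv/andP[H1 H2] : 0 <= m%:R * x by rewrite mulr_ge0 // ltW.
by rewrite in_itv /= ler_pdivrMr // ler_pdivlMr // ![x * _]mulrC H1 ltW.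
Qed.

(** The index [m] itself occurs at [x = 1], which is why cells are later indexed by ['I_m.+1]. *)
Lemma cell_index_le m x : 0 <= x <= 1 -> (cell_index m x <= m)%N.
Proof.
move=> /andP[x0 x1]; rewrite -(ler_nat R) /cell_index.
have /truncn_itv/andP[/le_trans-> //] : 0 <= m%:R * x by rewrite mulr_ge0.
by rewrite ler_piMr.
Qed.

(* The cells at cyclic distance at most [W] from cell [i]; the last two ranges
   account for the wrap-around of the torus. *)
Definition near_cells m W i : seq nat :=
  iota (i - W) (2 * W).+1 ++ iota (i + m - W) W.+1 ++ iota (i - m) W.+1.

Lemma size_near_cells m W i : size (near_cells m W i) = (4 * W + 3)%N.
Proof. by rewrite !size_cat !size_iota; lia. Qed.

Lemma tcoord_near_cells m W a b : (0 < m)%N -> 0 <= a <= 1 -> 0 <= b <= 1 ->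
  tcoord a b < W%:R / m%:R -> cell_index m b \in near_cells m W (cell_index m a).
Proof.
move=> m0 a01 b01; have m0R : 0 < m%:R :> R by rewrite ltr0n.
have := cell_index_le m _ a01; have := cell_index_le m _ b01.
have /truncn_itv : 0 <= m%:R * a by rewrite mulr_ge0 //; case/andP: a01.
have /truncn_itv : 0 <= m%:R * b by rewrite mulr_ge0 //; case/andP: b01.
rewrite /cell_index; set i := Num.truncn (_ * a); set j := Num.truncn (_ * b).
move=> jb ia jm im; rewrite ltr_pdivlMr // /tcoord.
rewrite !mem_cat !mem_iota.
(* The spare [1] is the error of rounding down to a cell index. *)
have cmp (p q : nat) : p%:R < q%:R + 1 :> R -> (p <= q)%N.
  by rewrite natr1 ltr_nat ltnS.
rewrite minEle; case: ifP => _ H.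
  have H1 : (j <= i + W)%N by apply: cmp; rewrite natrD; move: H; case: ger0P; nra.
  have H2 : (i <= j + W)%N by apply: cmp; rewrite natrD; move: H; case: ger0P; nra.
  by apply/orP; left; lia.
(* Here the minimum is [1 - |a - b|]: the short way from [a] to [b] passes through the identified
   endpoints 0 and 1. *)
case: (ger0P (a - b)) H => ab H.
  have H1 : (m + j <= i + W)%N by apply: cmp; rewrite !natrD; nra.
  by apply/orP; right; apply/orP; right; lia.
have H1 : (m + i <= j + W)%N by apply: cmp; rewrite !natrD; nra.
by apply/orP; right; apply/orP; left; lia.
Qed.

Lemma pt_unit s n (v : 'I_n) : size s = (2 * n)%N -> (forall t, t \in s -> 0 <= t <= 1) ->
  0 <= (pt s v).1 <= 1 /\ 0 <= (pt s v).2 <= 1.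
Proof.
move=> sn s01; have := ltn_ord v => vn.
by split; apply/s01/mem_nth; rewrite sn; lia.
Qed.

Definition cell_points n s m (ij : nat * nat) : {set 'I_n} :=
  [set v : 'I_n | ((pt s v).1 \in cell m ij.1) && ((pt s v).2 \in cell m ij.2)].

Section Counting.
Variables (n m K : nat) (s : seq R).
Hypotheses (m_gt0 : (0 < m)%N) (size_s : size s = (2 * n)%N).
Hypothesis s01 : forall t, t \in s -> 0 <= t <= 1.
Hypothesis cellK : forall i j : 'I_m.+1, (#|cell_points n s m (val i, val j)| <= K)%N.

Let index (v : 'I_n) := (cell_index m (pt s v).1, cell_index m (pt s v).2).

Lemma card_index_le ij : (#|[set v | index v == ij]| <= K)%N.
Proof.
(* An attained pair has both entries at most [m], where [cellK] applies; any other pair has an empty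
   class. *)
case: (boolP [exists v, index v == ij]) => [/existsP[v /eqP <-]|].
  have [p1 p2] := pt_unit _ _ v size_s s01.
  have im := cell_index_le m _ p1; have jm := cell_index_le m _ p2.
  apply: leq_trans (cellK (@Ordinal m.+1 _ im) (@Ordinal m.+1 _ jm)).
  apply: subset_leq_card.
  apply/fintype.subsetP => w; rewrite !finset.in_set /= => /eqP[<- <-].
  have [/andP[q1 _] /andP[q2 _]] := pt_unit _ _ w size_s s01.
  by rewrite !mem_cell_index.
rewrite negb_exists => /forallP H; rewrite (_ : [set v | _] = finset.set0) ?cards0 //.
by apply/setP => v; rewrite !inE (negbTE (H v)).
Qed.

(** The ball only meets cells at cyclic distance at most 1. The crude list [near_cells m 1] has 7
    entries for each coordinate, whence 49. *)
Lemma card_nbhd_le (r : R) (u : 'I_n) : r <= m%:R^-1 ->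
  (#|nbhd s r u| <= 49 * K)%N.
Proof.
move=> rm; have [p1 p2] := pt_unit _ _ u size_s s01.
pose l := [seq (i, j) | i <- near_cells m 1 (index u).1, j <- near_cells m 1 (index u).2].
have -> : (49 = size l)%N by rewrite size_allpairs !size_near_cells.
apply: leq_trans (card_mem_seq_le _ _ index K l card_index_le).
apply/subset_leq_card/fintype.subsetP => v; rewrite !finset.in_set => uv.
have [q1 q2] := pt_unit _ _ v size_s s01.
apply: allpairs_f; rewrite /index; apply: tcoord_near_cells => //.
  by rewrite mul1r (le_lt_trans (tcoord1_le_tdist _ _ _)) ?tcoord_ge0 // (lt_le_trans uv).
by rewrite mul1r (le_lt_trans (tcoord2_le_tdist _ _ _)) ?tcoord_ge0 // (lt_le_trans uv).
Qed.

(** Only the first coordinate is controlled; the second runs over all [m.+1] cells. *)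
Lemma card_strip_le (W : nat) (z : 'I_n) (C : {set 'I_n}) :
  (forall v, v \in C -> tcoord (pt s z).1 (pt s v).1 < W%:R / m%:R) ->
  (#|C| <= (4 * W + 3) * m.+1 * K)%N.
Proof.
move=> CW.
pose l := [seq (i, j) | i <- near_cells m W (index z).1, j <- iota 0 m.+1].
have -> : ((4 * W + 3) * m.+1 = size l)%N by rewrite size_allpairs size_near_cells size_iota.
apply: leq_trans (card_mem_seq_le _ _ index K l card_index_le).
apply/subset_leq_card/fintype.subsetP => v /CW vz; rewrite finset.in_set.
have [p1 p2] := pt_unit _ _ z size_s s01; have [q1 q2] := pt_unit _ _ v size_s s01.
apply: allpairs_f; rewrite /index; first exact: tcoord_near_cells.
by rewrite mem_iota ltnS cell_index_le.
Qed.

End Counting.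
End Torus.

(** * The conditional probability given the points *)

Section CondProb.
Variables (R : realType) (n : nat) (r eps : R) (s : seq R).
Hypothesis r_gt0 : 0 < r.

(** [sel_prob s r] is the product weight built from [w], so the estimates for random self-maps
    apply. *)
Let w (u v : 'I_n) : R := if v \in nbhd s r u then (#|nbhd s r u|%:R)^-1 else 0.

Lemma nbhd_self (u : 'I_n) : u \in nbhd s r u.
Proof. by rewrite finset.in_set /tdist !tcoordxx expr0n addr0 sqrtr0. Qed.

Lemma sel_weight_ge0 u v : 0 <= w u v.
Proof. by rewrite /w; case: ifP => // _; rewrite invr_ge0. Qed.

Lemma sel_weight_sum1 u : \sum_v w u v = 1.
Proof.
rewrite -big_mkcond /= sumr_const -[_ *+ _]mulr_natr mulVf // pnatr_eq0 -lt0n.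
by apply/card_gt0P; exists u; exact: nbhd_self.
Qed.

Lemma sel_prob_ge0 (c : {ffun 'I_n -> 'I_n}) : 0 <= sel_prob s r c.
Proof. by apply: (@weight_ge0 R _ w); exact: sel_weight_ge0. Qed.

Lemma cond_prob_ge0 : 0 <= cond_prob n r eps s.
Proof. by apply: sumr_ge0 => c _; exact: sel_prob_ge0. Qed.

Lemma cond_prob_le1 : cond_prob n r eps s <= 1.
Proof.
rewrite -(@weight_sum1 R _ w sel_weight_sum1) /cond_prob big_mkcond /=.
by apply: ler_sum => c _; case: ifP => // _; exact: sel_prob_ge0.
Qed.

(** * Configurations without crowded cells *)

Section Uncrowded.
Variables (m K L W : nat).
Hypotheses (m_gt0 : (0 < m)%N) (K_gt0 : (0 < K)%N) (size_s : size s = (2 * n)%N).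
Hypothesis s01 : forall t, t \in s -> 0 <= t <= 1.
Hypothesis cellK : forall i j : 'I_m.+1, (#|cell_points _ n s m (val i, val j)| <= K)%N.
Hypothesis rm : r <= m%:R^-1.
Hypothesis LrW : L%:R * r < W%:R / m%:R.
Hypothesis small : ((4 * W + 3) * m.+1 * K)%:R < eps * n%:R.

Lemma tcoord_iter (c : {ffun 'I_n -> 'I_n}) (v : 'I_n) i :
  (forall u, c u \in nbhd s r u) ->
  tcoord (pt s (iter i c v)).1 (pt s v).1 <= i%:R * r.
Proof.
move=> cN; elim: i => [|i IH]; first by rewrite tcoordxx mul0r.
have [p _] := pt_unit _ _ _ v size_s s01.
have [q1 _] := pt_unit _ _ _ (iter i c v) size_s s01.
have [q2 _] := pt_unit _ _ _ (iter i.+1 c v) size_s s01.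
apply: le_trans (tcoord_triangle _ _ _ _ q2 q1 p) _.
rewrite -natr1 mulrDl mul1r addrC lerD //.
have := cN (iter i c v); rewrite finset.in_set => /ltW.
have -> : tcoord (pt s (iter i.+1 c v)).1 (pt s (iter i c v)).1 =
  tcoord (pt s (iter i c v)).1 (pt s (iter i.+1 c v)).1 by rewrite /tcoord distrC.
by apply: le_trans; rewrite tcoord1_le_tdist // tcoord_ge0.
Qed.

(** If every walk repeats itself within [L] steps, each component stays within [L * r] of a single
    point in the first coordinate, hence in a strip that [small] makes too thin for [eps * n]
    points. *)
Lemma large_comp_uniq_traject (c : {ffun 'I_n -> 'I_n}) :
  (forall u, c u \in nbhd s r u) ->
  eps * n%:R <= (largest_comp (gamma_adj c))%:R ->
  exists u, uniq (traject c u L.+1).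
Proof.
move=> cN large; apply/existsP; move: large; apply: contraLR.
rewrite negb_exists => /forallP nu; rewrite -ltNge (le_lt_trans _ small) // ler_nat.
have loopL v : looping c v L by rewrite -[looping _ _ _]negbK -looping_uniq nu.
apply/bigmax_leqP => u _; have [z Hz] := component_attractor c L u loopL.
apply: (card_strip_le _ _ _ _ _ m_gt0 size_s s01 cellK W z) => v.
rewrite finset.in_set => /Hz /trajectP[i iL ->].
apply: le_lt_trans (tcoord_iter c v i cN) _; apply: le_lt_trans LrW.
by rewrite ler_pM2r // ler_nat ltnW.
Qed.

(** Union bound over the starting point of a long walk, which stays in place at each step with
    probability at least [1 / (49 * K)]. *)
Lemma cond_prob_le_uncrowded :
  cond_prob n r eps s <= n%:R * (1 - (49 * K)%:R^-1) ^+ L.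
Proof.
have p1 : (49 * K)%:R^-1 <= 1 :> R.
  by rewrite invf_le1 ?ltr0n ?muln_gt0 // ler1n muln_gt0.
have wp u : (49 * K)%:R^-1 <= w u u.
  have N0 : (0 < #|nbhd s r u|)%N by apply/card_gt0P; exists u; exact: nbhd_self.
  rewrite /w nbhd_self lef_pV2 ?posrE ?ltr0n ?muln_gt0 ?N0 // ler_nat.
  exact: (card_nbhd_le _ _ _ _ _ m_gt0 size_s s01 cellK).
have walk u := weight_uniq_traject R _ w sel_weight_ge0 sel_weight_sum1 _ finset.set0 u L p1 wp.
apply: (@le_trans _ _ (\sum_(u : 'I_n) (1 - (49 * K)%:R^-1) ^+ L)); last first.
  by rewrite sumr_const card_ord mulr_natl.
apply: le_trans (ler_sum _ (fun u _ => walk u)).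
rewrite /cond_prob big_mkcond /=.
under [leRHS]eq_bigr do rewrite big_mkcond /=.
rewrite exchange_big /=; apply: ler_sum => c _.
have sum_ge0 (F : pred 'I_n) :
    0 <= \sum_(u : 'I_n) (if F u then \prod_(x : 'I_n) w x (c x) else 0).
  by apply: sumr_ge0 => u _; case: ifP => // _; exact: sel_prob_ge0.
case: ifP => // large.
(* A map with some [c u] outside the ball of [u] has weight zero, so the deterministic lemma is
   applied only to the others. *)
case: (boolP [forall u, c u \in nbhd s r u]) => [/forallP cN|].
  have [u Uu] := large_comp_uniq_traject c cN large.
  have Au : all (fun x => x \notin finset.set0) (traject c u L.+1).
    by apply/allP => x _; rewrite finset.in_set0.
  rewrite (bigD1 u) // ifT; last by apply/andP; split; [exact: Uu | exact: Au].
  rewrite lerDl; apply: sumr_ge0 => x _; case: ifP => // _; exact: sel_prob_ge0.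
rewrite negb_forall => /existsP[u /negbTE cu].
rewrite /sel_prob [leLHS](bigD1 u) //= cu mul0r.
exact: (sum_ge0 (fun u => uniq (traject c u L.+1) && all (fun x => x \notin finset.set0)
  (traject c u L.+1))).
Qed.

End Uncrowded.

(* The product is [2] to the number of points in cell [ij], so the sum dominates
   the indicator of the event that some cell has more than [K] points. *)
Lemma cond_prob_le (m K L W : nat) : (0 < m)%N -> (0 < K)%N -> size s = (2 * n)%N ->
  (forall t, t \in s -> 0 <= t <= 1) -> r <= m%:R^-1 ->
  L%:R * r < W%:R / m%:R -> ((4 * W + 3) * m.+1 * K)%:R < eps * n%:R ->
  cond_prob n r eps s <= n%:R * (1 - (49 * K)%:R^-1) ^+ L +
    \sum_(ij : 'I_m.+1 * 'I_m.+1) 2 ^- K * \prod_(v < n)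
      (1 + ((pt s v).1 \in cell R m ij.1)%:R * ((pt s v).2 \in cell R m ij.2)%:R).
Proof.
move=> m0 K0 size_s s01 rm LrW small.
have beta0 : 0 <= n%:R * (1 - (49 * K)%:R^-1) ^+ L :> R.
  rewrite mulr_ge0 // exprn_ge0 // subr_ge0.
  by rewrite invf_le1 ?ltr0n ?muln_gt0 // ler1n muln_gt0.
have prod_count (ij : 'I_m.+1 * 'I_m.+1) : \prod_(v < n)
    (1 + ((pt s v).1 \in cell R m ij.1)%:R * ((pt s v).2 \in cell R m ij.2)%:R) =
    2 ^+ #|cell_points R n s m (val ij.1, val ij.2)| :> R.
  rewrite -prodr_const [RHS]big_mkcond /=; apply: eq_bigr => v _.
  rewrite finset.in_set /= -natrM mulnb; case: (_ && _) => //.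
  by rewrite addr0.
have term_ge0 (ij : 'I_m.+1 * 'I_m.+1) : 0 <= 2 ^- K * \prod_(v < n)
    (1 + ((pt s v).1 \in cell R m ij.1)%:R * ((pt s v).2 \in cell R m ij.2)%:R) :> R.
  by rewrite prod_count mulr_ge0 // ?invr_ge0 exprn_ge0.
case: (boolP [forall ij : 'I_m.+1 * 'I_m.+1,
  #|cell_points R n s m (val ij.1, val ij.2)| <= K]%N) => [/forallP cellK|].
  rewrite (le_trans (cond_prob_le_uncrowded m K L W _ _ _ _ _ _ _ _)) //.
    by move=> i j; exact: (cellK (i, j)).
  by rewrite lerDl sumr_ge0.
rewrite negb_forall => /existsP[ij]; rewrite -ltnNge => Kij.
apply: le_trans cond_prob_le1 _.
rewrite (bigD1 ij) //= prod_count addrCA addrC ler_wpDl //.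
  by rewrite addr_ge0 // sumr_ge0.
by rewrite mulrC ler_pdivlMr ?exprn_gt0 // mul1r ler_weXn2l ?ler1n // ltnW.
Qed.

End CondProb.

(** * Integration over the points *)

Local Open Scope classical_set_scope.
Local Open Scope ring_scope.

(* Monotonicity without measurability, since [iint_unit] integrates functions
   that are not known to be measurable. *)
Lemma ge0_le_integral_nomeas d (T : measurableType d) (R : realType)
    (mu : {measure set T -> \bar R}) (D : set T) (f g : T -> \bar R) :
  (forall x, D x -> 0 <= f x)%E -> (forall x, D x -> f x <= g x)%E ->
  (\int[mu]_(x in D) f x <= \int[mu]_(x in D) g x)%E.
Proof.
move=> f0 fg; have g0 x : D x -> (0 <= g x)%E.
  by move=> Dx; exact: le_trans (f0 x Dx) (fg x Dx).
rewrite !ge0_integralE //; apply: le_ereal_sup => _ [h hf <-]; exists h => //= x.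
apply: le_trans (hf x) _; rewrite !patchE; case: ifPn => // /set_mem.
exact: fg.
Qed.

Section IteratedIntegral.
Variable R : realType.
Implicit Types (F G : seq R -> \bar R) (s : seq R).

Lemma iint_unit_ge0 k F :
  (forall s, size s = k -> (forall t, t \in s -> 0 <= t <= 1) -> (0 <= F s)%E) ->
  (0 <= iint_unit k F)%E.
Proof.
elim: k F => [|k IH] F F0 /=; first exact: F0.
apply: integral_ge0 => t; rewrite /= in_itv /= => t01.
apply: IH => s sk s01; apply: F0 => /=; first by rewrite sk.
by move=> x; rewrite inE => /predU1P[->|/s01].
Qed.

Lemma le_iint_unit k F G :
  (forall s, size s = k -> (forall t, t \in s -> 0 <= t <= 1) ->
    (0 <= F s <= G s)%E) ->
  (iint_unit k F <= iint_unit k G)%E.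
Proof.
elim: k F G => [|k IH] F G FG /=; first by have /andP[] := FG [::] erefl (fun=> ltac:(done)).
have cons01 t s : `[0%R, 1%R]%classic t -> (forall x, x \in s -> 0 <= x <= 1) ->
    forall x, x \in t :: s -> 0 <= x <= 1.
  by rewrite /= in_itv /= => t01 s01 x; rewrite inE => /predU1P[->|/s01].
apply: ge0_le_integral_nomeas => t t01.
  apply: iint_unit_ge0 => s sk s01.
  by have /andP[] := FG (t :: s) (congr1 succn sk) (cons01 _ _ t01 s01).
apply: IH => s sk s01.
exact: FG (t :: s) (congr1 succn sk) (cons01 _ _ t01 s01).
Qed.

Lemma eq_iint_unit k F G : F =1 G -> iint_unit k F = iint_unit k G.
Proof. by move=> /funext ->. Qed.

(** The coefficients [e] let one lemma serve both coordinates of a point: in the inner integral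
    [e i] is the indicator for the first coordinate, in the outer one it is the length [l]. *)
Lemma integral_unit_affine (I : Type) (r : seq I) (c : R) (a e : I -> R)
    (J : I -> interval R) (l : I -> R) :
  0 <= c -> (forall i, 0 <= a i) -> (forall i, 0 <= e i) ->
  (forall i, lebesgue_measure ([set` J i] : set R) <= (l i)%:E)%E ->
  (\int[lebesgue_measure]_(t in `[0%R, 1%R])
     (c + \sum_(i <- r) a i * (1 + e i * (t \in J i)%:R))%:E <=
   (c + \sum_(i <- r) a i * (1 + e i * l i))%:E)%E.
Proof.
move=> c0 a0 e0 Jl.
have mI : measurable (`[0%R, 1%R]%classic : set R) by exact: measurable_itv.
have intc (x : R) : (\int[lebesgue_measure]_(t in `[0%R, 1%R]) x%:E = x%:E)%E.
  rewrite integral_cst //= lebesgue_measure_itv /= lte_fin ltr01.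
  by rewrite oppr0 adde0 mule1.
have mJ i : measurable_fun (`[0%R, 1%R]%classic : set R) (fun t : R => (t \in J i)%:R : R).
  rewrite (_ : (fun _ => _) = \1_[set` J i]).
    exact: measurable_indic.
  by apply/funext => t; rewrite indicE; congr (_%:R); rewrite mem_setE.
have mJe i : measurable_fun (`[0%R, 1%R]%classic : set R)
    (fun t : R => e i * (t \in J i)%:R) by exact: measurable_funM.
have mJe1 i : measurable_fun (`[0%R, 1%R]%classic : set R)
    (fun t : R => 1 + e i * (t \in J i)%:R) by exact: measurable_funD.
have mE i : measurable_fun (`[0%R, 1%R]%classic : set R)
    (fun t : R => a i * (1 + e i * (t \in J i)%:R)) by exact: measurable_funM.
have E0 i (t : R) : (0 <= (a i * (1 + e i * (t \in J i)%:R))%:E)%E.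
  by rewrite lee_fin mulr_ge0 // addr_ge0 // mulr_ge0.
under eq_integral => t _ do rewrite EFinD -sumEFin.
rewrite ge0_integralD //=; last first.
- by apply: emeasurable_sum => i; apply/measurable_EFinP; exact: mE.
- by move=> t _; apply: sume_ge0.
rewrite intc EFinD leeD2l // ge0_integral_sum //=; last first.
  by move=> i; apply/measurable_EFinP; exact: mE.
rewrite -sumEFin; apply: lee_sum => i _.
under eq_integral => t _ do rewrite EFinM.
rewrite ge0_integralZl_EFin //=; last 2 first.
- by move=> t _; rewrite lee_fin addr_ge0 // mulr_ge0.
- by apply/measurable_EFinP; exact: mJe1.
rewrite EFinM lee_wpmul2l ?lee_fin //.
under eq_integral => t _ do rewrite EFinD EFinM.
rewrite ge0_integralD //=; last 2 first.
- by move=> t _; rewrite -EFinM lee_fin mulr_ge0.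
- by apply/measurable_EFinP; exact: mJe.
rewrite intc EFinD leeD2l // ge0_integralZl_EFin //=; last by apply/measurable_EFinP; exact: mJ.
rewrite EFinM lee_wpmul2l ?lee_fin //.
apply: le_trans (Jl i).
have indE t : (t \in J i)%:R = \1_([set` J i] : set R) t :> R.
  by rewrite indicE; congr (_%:R); rewrite mem_setE.
under eq_integral => t _ do rewrite indE.
rewrite integral_indic //; apply: le_measure; rewrite ?inE //.
- by apply: measurableI.
Qed.

(** Exponential moments of the numbers of points in rectangles, integrating out one point at a time.
    The constant and the sum stay inside the integral, to match the bound of [cond_prob_le]. *)
Lemma iint_unit_prod (I : Type) (r : seq I) (c l : R) (a : I -> R)
    (J1 J2 : I -> interval R) n :
  0 <= c -> 0 <= l -> (forall i, 0 <= a i) ->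
  (forall i, lebesgue_measure ([set` J1 i] : set R) <= l%:E)%E ->
  (forall i, lebesgue_measure ([set` J2 i] : set R) <= l%:E)%E ->
  (iint_unit (2 * n) (fun s => (c + \sum_(i <- r) a i * \prod_(v < n)
      (1 + ((pt s v).1 \in J1 i)%:R * ((pt s v).2 \in J2 i)%:R))%:E) <=
   (c + \sum_(i <- r) a i * (1 + l * l) ^+ n)%:E)%E.
Proof.
move=> c0 l0 + J1l J2l; elim: n a => [|n IH] a a0.
  rewrite muln0 /= lee_fin lerD2l; apply: ler_sum => i _.
  by rewrite big_ord0 expr0.
(* The factor of the first point is absorbed into the coefficients, over which the induction
   hypothesis is general. *)
pose b t1 t2 i : R := a i * (1 + (t1 \in J1 i)%:R * (t2 \in J2 i)%:R).
have b0 t1 t2 i : 0 <= b t1 t2 i by rewrite mulr_ge0 // addr_ge0 // mulr_ge0.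
rewrite mulnS.
have step t1 t2 : (iint_unit (2 * n) (fun s => (c + \sum_(i <- r) a i * \prod_(v < n.+1)
      (1 + ((pt [:: t1, t2 & s] v).1 \in J1 i)%:R *
           ((pt [:: t1, t2 & s] v).2 \in J2 i)%:R))%:E) <=
    (c + \sum_(i <- r) a i * (1 + l * l) ^+ n *
        (1 + (t1 \in J1 i)%:R * (t2 \in J2 i)%:R))%:E)%E.
  rewrite [leRHS](_ : _ = (c + \sum_(i <- r) b t1 t2 i * (1 + l * l) ^+ n)%:E).
    2: by congr (_ + _)%:E; apply: eq_bigr => i _; rewrite /b mulrAC.
  apply: le_trans (IH _ (b0 t1 t2)).
  rewrite le_eqVlt; apply/orP; left; apply/eqP.
  apply: eq_iint_unit => s; congr (_ + _)%:E; apply: eq_bigr => i _.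
  rewrite big_ord_recl mulrA; congr (_ * _); apply: eq_bigr => v _.
  by rewrite /pt lift0 mulnS !add2n.
have a'0 i : 0 <= a i * (1 + l * l) ^+ n.
  by rewrite mulr_ge0 // exprn_ge0 // addr_ge0 // mulr_ge0.
have -> : c + \sum_(i <- r) a i * (1 + l * l) ^+ n.+1 =
   c + \sum_(i <- r) a i * (1 + l * l) ^+ n * (1 + l * l).
  by congr (_ + _); apply: eq_bigr => i _; rewrite exprSr mulrA.
apply: le_trans (@integral_unit_affine I r c _ (fun=> l) J1 (fun=> l) c0 a'0
   (fun=> l0) J1l).
have F0 t1 t2 s : (0 <= (c + \sum_(i <- r) a i * \prod_(v < n.+1)
      (1 + ((pt [:: t1, t2 & s] v).1 \in J1 i)%:R *
           ((pt [:: t1, t2 & s] v).2 \in J2 i)%:R))%:E)%E.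
  rewrite lee_fin addr_ge0 // sumr_ge0 // => i _; rewrite mulr_ge0 //.
  by apply: prodr_ge0 => v _; rewrite addr_ge0 // mulr_ge0.
rewrite add2n; apply: ge0_le_integral_nomeas => t1 _.
  by apply: integral_ge0 => t2 _; apply: iint_unit_ge0 => s _ _; exact: F0.
rewrite [leRHS](_ : _ = (c + \sum_(i <- r)
    a i * (1 + l * l) ^+ n * (1 + (t1 \in J1 i)%:R * l))%:E); last first.
  by congr (_ + _)%:E; apply: eq_bigr => i _; rewrite [l * _%:R]mulrC.
apply: le_trans (@integral_unit_affine I r c _ (fun i => (t1 \in J1 i)%:R) J2
  (fun=> l) c0 a'0 (fun i => ler0n _ _) J2l).
apply: ge0_le_integral_nomeas => t2 _; last exact: step.
by apply: iint_unit_ge0 => s _ _; exact: F0.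
Qed.

End IteratedIntegral.

Lemma lebesgue_measure_cell (R : realType) m i : (0 < m)%N ->
  (lebesgue_measure ([set` cell R m i] : set R) <= (m%:R^-1)%:E)%E.
Proof.
move=> m0; rewrite lebesgue_measure_itv /=; case: ifP => _; last by rewrite lee_fin.
by rewrite -EFinB lee_fin -mulrBl -natr1 addrAC subrr add0r mul1r.
Qed.

Lemma prob_large_comp_ge0 (R : realType) n (r eps : R) : 0 < r ->
  (0 <= prob_large_comp n r eps)%E.
Proof. by move=> r0; apply: iint_unit_ge0 => s _ _; rewrite lee_fin cond_prob_ge0. Qed.

(** The walk term is constant; each of the [m.+1 ^ 2] cells contributes [2 ^- K] times the moment
    bound [(1 + m ^ -2) ^ n]. *)
Lemma prob_large_comp_le (R : realType) (n m K L W : nat) (r eps : R) :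
  0 < r -> (0 < m)%N -> (0 < K)%N -> r <= m%:R^-1 ->
  L%:R * r < W%:R / m%:R -> ((4 * W + 3) * m.+1 * K)%:R < eps * n%:R ->
  (prob_large_comp n r eps <=
   (n%:R * (1 - (49 * K)%:R^-1) ^+ L +
    m.+1%:R ^+ 2 * 2 ^- K * (1 + m%:R^-1 ^+ 2) ^+ n)%:E)%E.
Proof.
move=> r0 m0 K0 rm LrW small.
have beta0 : 0 <= n%:R * (1 - (49 * K)%:R^-1) ^+ L :> R.
  rewrite mulr_ge0 // exprn_ge0 // subr_ge0.
  by rewrite invf_le1 ?ltr0n ?muln_gt0 // ler1n muln_gt0.
have := @iint_unit_prod R ('I_m.+1 * 'I_m.+1)%type (index_enum _)
  (n%:R * (1 - (49 * K)%:R^-1) ^+ L) m%:R^-1 (fun=> 2 ^- K)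
  (fun ij => cell R m ij.1) (fun ij => cell R m ij.2) n beta0.
have mV0 : 0 <= m%:R^-1 :> R by rewrite invr_ge0.
have K20 : 0 <= 2 ^- K :> R by rewrite invr_ge0 exprn_ge0.
move=> /(_ mV0 (fun=> K20) (fun ij => lebesgue_measure_cell R m _ m0)
  (fun ij => lebesgue_measure_cell R m _ m0)).
rewrite sumr_const card_prod card_ord -(mulr_natl (_ * _)) (natrM _ m.+1) -!expr2 mulrA.
apply: le_trans; apply: le_iint_unit => s size_s s01.
by rewrite !lee_fin cond_prob_ge0 //= (cond_prob_le _ _ _ _ _ _ _ _ _ W).
Qed.

(** * Asymptotics *)

Section Asymptotics.
Variable R : realType.

(** The exponent 5 serves twice: it turns [a ^ 2 * (a ^ 2 / n) ^ 5] into
    [(a ^ 3) ^ 4 / n ^ 5 = l ^ 4 / n] for crowded cells, and through [ln_pow5_le] it makes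
    [l ^ 4 / n] of order [1 / l]. *)
Lemma expR_ge_pow5 (x : R) : 0 <= x -> (x / 5) ^+ 5 <= expR x.
Proof.
move=> x0; have -> : expR x = expR (x / 5) ^+ 5.
  by rewrite -expRM_natl; congr expR; field.
rewrite lerXn2r ?nnegrE ?expR_ge0 ?divr_ge0 //.
by apply: le_trans (expR_ge1Dx _); rewrite lerDr.
Qed.

Lemma expR1_le4 : expR 1 <= 4 :> R.
Proof.
have H : 2^-1 <= expR (- 2^-1) :> R.
  by apply: le_trans (expR_ge1Dx _); lra.
have -> : expR 1 = (expR (- 2^-1))^-1 ^+ 2 :> R.
  by rewrite -expRN opprK -expRM_natl; congr expR; field.
have -> : 4 = 2 ^+ 2 :> R by ring.
rewrite lerXn2r ?nnegrE ?invr_ge0 ?expR_ge0 //.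
by rewrite -[leRHS]invrK lef_pV2 ?posrE ?expR_gt0 ?invr_gt0.
Qed.

Lemma pow_le_expR (x : R) k : 0 <= 1 + x -> (1 + x) ^+ k <= expR (k%:R * x).
Proof.
by move=> x0; rewrite expRM_natl lerXn2r ?nnegrE ?expR_ge0 // expR_ge1Dx.
Qed.


(** The successor form provides a positive integer, as wanted for [K], [L] and [W]. *)
Lemma exists_nat_ceil (x : R) : 0 <= x -> exists k : nat, x < k.+1%:R <= x + 1.
Proof.
move=> /truncn_itv/andP[x1 x2]; exists (Num.truncn x).
by rewrite x2 -natr1 lerD2r.
Qed.

(** [Q * l <= 8 * N * l / a ^ 2 = 8 * a]; the added 1 is absorbed by [1 <= Q * l], which raises 392
    to 393. *)
Lemma walk_length_le (N Q a l L : R) : 1 <= a -> 1 <= l -> 1 <= Q ->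
  a ^+ 3 = N * l -> Q * a ^+ 2 <= 8 * N -> L <= 392 * Q * l + 1 -> L <= 393 * 8 * a.
Proof.
move=> a1 l1 Q1 a3 Qa Ll.
have a20 : 0 < a ^+ 2 by rewrite exprn_gt0 // (lt_le_trans ltr01).
have Ql : 1 <= Q * l by rewrite -[1]mulr1 ler_pM.
have H : L <= 393 * (Q * l) by move: Ll Ql; rewrite -mulrA; clear; lra.
rewrite -(ler_pM2r a20).
have -> : 393 * 8 * a * a ^+ 2 = 393 * 8 * (N * l) by rewrite -a3; ring.
apply: le_trans (ler_wpM2r (ltW a20) H) _.
have l0 : 0 <= l by apply: le_trans l1.
have := ler_wpM2r l0 Qa; clear; lra.
Qed.

(** Here [M = m], [N = n] and [4 * Q = K]. Since [M * Q = O(N / a)] and [W = O(a r M + 1)], the left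
    side is [O((a r + 1 / a) N)]. *)
Lemma strip_small (C N Q M W L a r eps : R) : 0 < r -> 0 < N -> 0 <= C -> 0 <= Q -> 0 <= W ->
  1 <= M -> M <= a -> a <= 2 * M -> Q * M ^+ 2 <= 2 * N -> L <= C * a ->
  W <= L * r * M + 1 -> 32 * (4 * C * (a * r) + 7 / a) < eps ->
  (4 * W + 3) * (M + 1) * (4 * Q) < eps * N.
Proof.
move=> r0 N0 C0 Q0 W0 M1 Ma aM QM La WL small.
have M0 : 0 < M by apply: lt_le_trans M1.
have a0 : 0 < a by apply: lt_le_trans Ma.
have x0 : 0 <= a * r by rewrite mulr_ge0 // ltW.
have Wx : 4 * W + 3 <= 4 * C * (a * r) * M + 7.
  have : L * r * M <= C * a * r * M by rewrite !ler_wpM2r // ltW.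
  move: WL; clear; lra.
have MQ0 : 0 <= M * Q by rewrite mulr_ge0 // ltW.
have MQa : M * Q * a <= 4 * N.
  by move: (ler_wpM2l MQ0 aM) QM; clear; lra.
have MQ : M * Q <= 4 * (N / a) by rewrite mulrA ler_pdivlMr.
have MQ1 : (M + 1) * Q <= 2 * (M * Q).
  by move: (ler_wpM2r Q0 M1); clear; lra.
have H1 : (4 * W + 3) * (4 * ((M + 1) * Q)) <= (4 * C * (a * r) * M + 7) * (8 * (M * Q)).
  apply: ler_pM => //; [|by rewrite !mulr_ge0 // addr_ge0 // ltW|].
    by rewrite addr_ge0 // mulr_ge0.
  by move: MQ1; clear; lra.
have H2 : (a * r) * (Q * M ^+ 2) <= (a * r) * (2 * N) by rewrite ler_wpM2l.
have H3 : 32 * (4 * C * (a * r) + 7 / a) * N < eps * N by rewrite ltr_pM2r.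
have H4 : 0 <= a * r * N by rewrite mulr_ge0 // ltW.
have -> : (4 * W + 3) * (M + 1) * (4 * Q) = (4 * W + 3) * (4 * ((M + 1) * Q)) by ring.
apply: le_lt_trans H1 _; apply: le_lt_trans H3.
have -> : (4 * C * (a * r) * M + 7) * (8 * (M * Q)) =
  32 * C * (a * r * (Q * M ^+ 2)) + 56 * (M * Q) by ring.
have -> : 32 * (4 * C * (a * r) + 7 / a) * N = 128 * C * (a * r * N) + 224 * (N / a).
  by ring.
have C0' : 0 <= 32 * C by rewrite mulr_ge0.
move: (ler_wpM2l C0' H2) (mulr_ge0 C0' H4) MQ; clear; lra.
Qed.

(** With [K = 4 * q], the factor [2 ^- K] is [4 ^- q] twice: one copy cancels the exponential
    moment, which is at most [expR q], and the other outweighs the number of cells. *)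
Lemma crowded_cell_small (n q : nat) (M a l : R) :
  0 < n%:R :> R -> 1 <= M -> M <= a -> a ^+ 3 = n%:R * l -> (0 < q)%N ->
  n%:R <= q%:R * M ^+ 2 ->
  (M + 1) ^+ 2 * 2 ^- (4 * q) * (1 + M^-1 ^+ 2) ^+ n <= 2 ^+ 2 * 5 ^+ 5 * (l ^+ 4 / n%:R).
Proof.
move=> n0 M1 Ma a3 q0 nqM.
have M0 : 0 < M by apply: lt_le_trans M1.
have a0 : 0 < a by apply: lt_le_trans Ma.
have Q0 : 0 < q%:R :> R by rewrite ltr0n.
have H4 : expR q%:R <= 4 ^+ q :> R.
  rewrite -[q%:R]mulr1 expRM_natl lerXn2r ?nnegrE ?expR_ge0 //.
  exact: expR1_le4.
have H5 : (1 + M^-1 ^+ 2) ^+ n <= 4 ^+ q.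
  apply: le_trans H4; apply: le_trans (pow_le_expR _ _ _) _.
    by rewrite addr_ge0 // exprn_ge0 // invr_ge0 ltW.
  by rewrite ler_expR exprVn ler_pdivrMr ?exprn_gt0.
have K16 : 2 ^- (4 * q) = (4 ^+ q)^-1 * (4 ^+ q)^-1 :> R.
  by rewrite exprM -invfM -exprMn; congr (_ ^+ _)^-1; ring.
have aQ : n%:R / a ^+ 2 <= q%:R.
  rewrite ler_pdivrMr ?exprn_gt0 // (le_trans nqM) // ler_wpM2l ?(ltW Q0) //.
  by rewrite lerXn2r ?nnegrE ?(ltW M0) ?(ltW a0).
have H6 : (4 ^+ q)^-1 <= (5 * (a ^+ 2 / n%:R)) ^+ 5.
  apply: (@le_trans _ _ ((q%:R / 5) ^+ 5)^-1).
    rewrite lef_pV2 ?posrE ?exprn_gt0 ?divr_gt0 //.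
    by apply: le_trans H4; rewrite expR_ge_pow5 // ltW.
  rewrite -exprVn lerXn2r ?nnegrE ?invr_ge0 ?divr_ge0 ?mulr_ge0 ?exprn_ge0 ?invr_ge0
    ?(ltW n0) ?(ltW a0) ?(ltW Q0) //.
  rewrite invfM invrK mulrC ler_wpM2l // -[leRHS]invrK lef_pV2 ?posrE ?invr_gt0 //.
    by rewrite invfM invrK mulrC.
  by rewrite divr_gt0 ?exprn_gt0.
have H7 : (M + 1) ^+ 2 <= (2 * a) ^+ 2.
  rewrite lerXn2r ?nnegrE ?mulr_ge0 ?addr_ge0 ?(ltW M0) ?(ltW a0) //.
  by move: M1 Ma; clear; lra.
have q40 : 0 < 4 ^+ q :> R by rewrite exprn_gt0.
have X0 : 0 <= (4 ^+ q)^-1 :> R by rewrite invr_ge0 ltW.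
have H8 : (4 ^+ q)^-1 * (1 + M^-1 ^+ 2) ^+ n <= 1.
  by rewrite mulrC ler_pdivrMr // mul1r.
rewrite K16 [(M + 1) ^+ 2 * (_ * _)]mulrA -[X in X <= _]mulrA.
have M10 : 0 <= (M + 1) ^+ 2 by rewrite exprn_ge0 // addr_ge0 // ltW.
apply: (@le_trans _ _ ((2 * a) ^+ 2 * (5 * (a ^+ 2 / n%:R)) ^+ 5)).
  have Y0 : 0 <= (1 + M^-1 ^+ 2) ^+ n.
    by rewrite exprn_ge0 // addr_ge0 // exprn_ge0 // invr_ge0 ltW.
  rewrite -[leRHS]mulr1; apply: ler_pM H8; [exact: mulr_ge0|exact: mulr_ge0|].
  exact: ler_pM.
have n_neq0 := lt0r_neq0 n0.
have E (b c : R) : (b * a) ^+ 2 * (c * (a ^+ 2 / n%:R)) ^+ 5 =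
    b ^+ 2 * c ^+ 5 * ((a ^+ 3) ^+ 4 / n%:R ^+ 5) by field.
rewrite E a3 ler_wpM2l //.
by have -> : (n%:R * l) ^+ 4 / n%:R ^+ 5 = l ^+ 4 / n%:R by field.
Qed.

(** [(1 - 1 / D) ^ L <= expR (- L / D) <= n ^ -2]; the factor 2 in the length pays for the union
    bound over [n] starting points. *)
Lemma escape_small (n L : nat) (D l : R) : 0 < n%:R :> R -> l = ln n%:R -> 1 <= D ->
  2 * D * l <= L%:R -> n%:R * (1 - D^-1) ^+ L <= n%:R^-1.
Proof.
move=> n0 lE D1 DL; have D0 : 0 < D by apply: lt_le_trans D1.
have NE : expR l = n%:R by rewrite lE lnK.
have HD : (1 - D^-1) ^+ L <= n%:R^-1 ^+ 2.
  apply: le_trans (pow_le_expR _ _ _) _; first by rewrite subr_ge0 invf_le1.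
  rewrite -NE -expRN -expRM_natl ler_expR !mulrN lerN2 ler_pdivlMr //.
  by move: DL; clear; lra.
apply: le_trans (ler_wpM2l (ltW n0) HD) _.
by rewrite expr2 mulrA divff ?mul1r // lt0r_neq0.
Qed.

(** Parameters: [m] is the integer part of [a], [K = 4 * q] with [q] about [n / m ^ 2], the walk
    length is about [98 * K * l], and the strip width in cells is about that length times
    [r * m]. *)
Lemma prob_large_comp_asymp (n : nat) (C r eps a l : R) :
  393 * 8 <= C -> 0 < r -> l = ln n%:R -> 1 <= l -> 1 <= a -> a ^+ 3 = n%:R * l ->
  a ^+ 2 <= n%:R -> a * r <= 1 -> 32 * (4 * C * (a * r) + 7 / a) < eps ->
  (prob_large_comp n r eps <= (n%:R^-1 + 2 ^+ 2 * 5 ^+ 5 * (l ^+ 4 / n%:R))%:E)%E.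
Proof.
move=> leC r0 lE l1 a1 a3 a2n ar small.
have C0 : 0 <= C by exact: le_trans (mulr_ge0 (ler0n _ _) (ler0n _ _)) leC.
have a0 : 0 < a by apply: lt_le_trans a1.
have l0 : 0 < l by apply: lt_le_trans l1.
have n0 : 0 < n%:R :> R by apply: lt_le_trans a2n; rewrite exprn_gt0.
have [m [m0 Ma aM]] : exists m, [/\ (0 < m)%N, m%:R <= a & a <= 2 * m%:R :> R].
  exists (Num.truncn a); have /andP[H1 H2] := truncn_itv (ltW a0).
  have m0 : (0 < Num.truncn a)%N by rewrite truncn_gt0.
  split=> //; apply: le_trans (ltW H2) _.
  by rewrite -natr1 mulrC mulr_natr mulr2n lerD2l ler1n.
have M1 : 1 <= m%:R :> R by rewrite ler1n.
have M0 : 0 < m%:R :> R by rewrite ltr0n.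
have M20 : 0 < m%:R ^+ 2 :> R by rewrite exprn_gt0.
have M2 : m%:R ^+ 2 <= n%:R :> R.
  by apply: le_trans a2n; rewrite lerXn2r ?nnegrE ?(ltW a0).
have [q [q0 NQ QM]] : exists q : nat, [/\ (0 < q)%N, n%:R <= q%:R * m%:R ^+ 2 :> R &
    q%:R * m%:R ^+ 2 <= 2 * n%:R :> R].
  have [|q /andP[H1 H2]] := exists_nat_ceil (n%:R / m%:R ^+ 2).
    by rewrite divr_ge0 // ltW.
  exists q.+1; split=> //; first by rewrite -ler_pdivrMr // ltW.
  rewrite -ler_pdivlMr // (le_trans H2) // -mulrA [leRHS]mulrC mulr_natr mulr2n.
  by rewrite lerD2l ler_pdivlMr ?mul1r.
have Q1 : 1 <= q%:R :> R by rewrite ler1n.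
have Q0 : 0 <= q%:R :> R by [].
have Qa : q%:R * a ^+ 2 <= 8 * n%:R.
  have a2M : a ^+ 2 <= 4 * m%:R ^+ 2.
    have -> : 4 * m%:R ^+ 2 = (2 * m%:R) ^+ 2 :> R by ring.
    by rewrite lerXn2r ?nnegrE ?mulr_ge0 ?(ltW a0).
  by move: (ler_wpM2l Q0 a2M) QM; clear; lra.
have DE : (49 * (4 * q))%:R = 196 * q%:R :> R by rewrite mulnA natrM.
have D1 : 1 <= 196 * q%:R :> R by rewrite -DE ler1n !muln_gt0.
have [L /andP[L1 L2]] := exists_nat_ceil _
  (mulr_ge0 (mulr_ge0 (ler0n _ 2) (le_trans ler01 D1)) (ltW l0)).
have La : L.+1%:R <= C * a.
  apply: le_trans (ler_wpM2r (ltW a0) leC).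
  apply: (walk_length_le _ _ _ _ _ a1 l1 Q1 a3 Qa).
  by have -> : 392 * q%:R * l = 2 * (196 * q%:R) * l by ring.
have [W /andP[W1 W2]] := exists_nat_ceil _
  (mulr_ge0 (mulr_ge0 (ler0n _ L.+1) (ltW r0)) (ltW M0)).
have rM : r <= m%:R^-1.
  rewrite -div1r ler_pdivlMr // mulrC (le_trans _ ar) // ler_wpM2r // ltW //.
have LrW : L.+1%:R * r < W.+1%:R / m%:R by rewrite ltr_pdivlMr.
have big : ((4 * W.+1 + 3) * m.+1 * (4 * q))%:R < eps * n%:R.
  have -> : ((4 * W.+1 + 3) * m.+1 * (4 * q))%:R =
      (4 * W.+1%:R + 3) * (m%:R + 1) * (4 * q%:R) :> R.
    by rewrite !(natrM, natrD) -[m.+1%:R]natr1.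
  exact: (strip_small _ _ _ _ _ _ _ _ _ r0 n0 C0 Q0 (ler0n _ _) M1 Ma aM QM La W2 small).
apply: le_trans (prob_large_comp_le _ _ m (4 * q) L.+1 W.+1 _ _ r0 m0 _ rM LrW big) _.
  by rewrite muln_gt0.
rewrite lee_fin lerD //.
  by rewrite DE (escape_small _ _ _ l) // ltW.
by rewrite -natr1 (crowded_cell_small _ _ _ a).
Qed.

Lemma ln_pow5_le (n : nat) : 0 <= ln n%:R :> R -> ln n%:R ^+ 5 <= 5 ^+ 5 * n%:R :> R.
Proof.
(* At [n = 0] the logarithm takes its default value 0. *)
case: n => [|n] l0; first by rewrite ln0 // expr0n mulr0.
rewrite mulrC -ler_pdivrMr ?exprn_gt0 // -expr_div_n -[leRHS](@lnK R) ?posrE //.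
exact: expR_ge_pow5.
Qed.

(** The source is [l ^ 5 <= 5 ^ 5 * n]: with [5 ^ 5 <= l] it gives [l ^ 2 <= n], hence [l <= a] and
    [a ^ 2 <= n], and it bounds [l ^ 4 / n] by [5 ^ 5 / l]. *)
Lemma prob_large_comp_le_ln (n : nat) (C r eps : R)
    (a := (n%:R * ln n%:R) `^ 3^-1) (l := ln n%:R) :
  393 * 8 <= C -> 0 < r -> 0 < eps -> 5 ^+ 5 <= l -> a * r <= 1 ->
  128 * C * (a * r) < eps / 2 -> 32 * 7 / (eps / 2) < l ->
  (prob_large_comp n r eps <= ((1 + 2 ^+ 2 * 5 ^+ 5 * 5 ^+ 5) * l^-1)%:E)%E.
Proof.
move=> leC r0 eps0 l55 ar1 ar2 leps.
have l1 : 1 <= l by apply: le_trans l55; rewrite exprn_ege1 // ler1n.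
have l0 : 0 < l by apply: lt_le_trans l1.
have n0 : 0 < n%:R :> R.
  by rewrite ltr0n lt0n; apply: contraTneq l0 => n0; rewrite /l n0 ln0 ?ltxx.
have l5 := ln_pow5_le n (ltW l0); rewrite -/l in l5.
have l2n : l ^+ 2 <= n%:R.
  rewrite -(ler_pM2l (exprn_gt0 3 l0)) -exprD (le_trans l5) // ler_wpM2r //.
  by rewrite (le_trans l55) // -[leLHS]expr1 ler_weXn2l.
have ln_le : l <= n%:R by apply: le_trans l2n; rewrite -[leLHS]expr1 ler_weXn2l.
have nl0 : 0 <= n%:R * l by rewrite mulr_ge0 // ltW.
have a0 : 0 <= a by exact: powR_ge0.
have a3 : a ^+ 3 = n%:R * l.
  by rewrite /a -powR_mulrn // -powRrM mulVf // powRr1.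
have la : l <= a.
  by rewrite -(@ler_pXn2r _ 3) ?nnegrE ?(ltW l0) // a3 exprSr ler_wpM2r ?(ltW l0).
have a2n : a ^+ 2 <= n%:R.
  rewrite -(@ler_pXn2r _ 3) ?nnegrE ?exprn_ge0 // -exprM mulnC exprM a3 exprMn.
  by rewrite [leRHS]exprSr ler_wpM2l ?exprn_ge0.
apply: le_trans (prob_large_comp_asymp n C r eps a l leC r0 _ l1 _ a3 a2n ar1 _) _ => //.
- exact: le_trans la.
(* Since [l <= a], the lower bound on [l] controls [7 / a]; each of the two terms receives half of
   [eps]. *)
- have H : 32 * (7 / a) < eps / 2.
    rewrite mulrA ltr_pdivrMr ?(lt_le_trans l0) // -ltr_pdivrMl ?divr_gt0 //.
    by rewrite mulrC (lt_le_trans leps).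
  have -> : 32 * (4 * C * (a * r) + 7 / a) = 128 * C * (a * r) + 32 * (7 / a) by ring.
  by rewrite [ltRHS]splitr ltrD.
rewrite lee_fin mulrDl mul1r lerD //; first by rewrite lef_pV2 ?posrE.
rewrite -[leRHS]mulrA ler_wpM2l ?mulr_ge0 ?exprn_ge0 //.
by rewrite ler_pdivrMr // mulrAC ler_pdivlMr // -exprSr.
Qed.

End Asymptotics.

Theorem theorem2 (R : realType) (r : nat -> R) (r_pos : forall n, 0 < r n)
  (r_small : (fun n : nat => r n / ((n%:R * ln (n%:R : R)) `^ (- 3^-1))) @ \oo --> 0) :
  forall eps : R, 0 < eps ->
    (fun n : nat => prob_large_comp n (r n) eps) @ \oo --> 0%E.
Proof.
move=> eps eps0.
have lnR : (fun n : nat => ln n%:R : R) @ \oo --> +oo.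
  apply/cvgryPge => A; near=> n.
  have An : expR A <= n%:R by near: n; exact: nbhs_infty_ger.
  by rewrite -[leLHS]expRK ler_ln ?posrE ?(lt_le_trans _ An) ?expR_gt0.
have ln_ge A : \forall n \near \oo, A <= ln n%:R :> R.
  by move: A; exact/cvgryPge.
have ln_gt A : \forall n \near \oo, A < ln n%:R :> R.
  by move: A; exact/cvgryPgt.
have lnV : (fun n : nat => (ln n%:R : R)^-1) @ \oo --> 0.
  by apply/gtr0_cvgV0 => //; exact: ln_gt.
pose a n : R := (n%:R * ln n%:R) `^ 3^-1.
have ar0 : (fun n => a n * r n) @ \oo --> 0.
  apply: cvg_trans r_small; apply: near_eq_cvg; near=> n.
  by rewrite powRN invrK mulrC.
have ar_le d : 0 < d -> \forall n \near \oo, a n * r n < d.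
  by move=> d0; exact: cvgr_lt ar0 d d0.
(* Only the lower bound is kept, so that [C] is opaque in the estimates. *)
have [C leC] : exists C : R, 393 * 8 <= C by exists (393 * 8).
have C0 : 0 < C by apply: lt_le_trans leC; rewrite -natrM ltr0n.
apply: (@squeeze_cvge _ _ _ _ (fun=> 0%E) _
  (fun n => ((1 + 2 ^+ 2 * 5 ^+ 5 * 5 ^+ 5) * (ln n%:R : R)^-1)%:E)).
- near=> n; apply/andP; split; first exact: prob_large_comp_ge0.
  apply: (@prob_large_comp_le_ln R n C) => //.
  + by near: n; exact: ln_ge.
  + by apply: ltW; near: n; exact: ar_le.
  + rewrite -ltr_pdivlMl ?mulr_gt0 //; near: n; apply: ar_le.
    by rewrite mulr_gt0 ?invr_gt0 ?divr_gt0 ?mulr_gt0.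
  + by near: n; exact: ln_gt.
- exact: cvg_cst.
- apply: cvg_EFin; first exact: nearW.
  rewrite -[X in _ --> X](mulr0 (1 + 2 ^+ 2 * 5 ^+ 5 * 5 ^+ 5)).
  exact: cvgMr lnV.
Unshelve. all: by end_near.
Qed.
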